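(* Let $\lambda$ be a partition of $n$, $(\alpha|\beta)$ a bicomposition of $n$ and $\mathbb{F}$ a field. Suppose that $\mathfrak{a}^{\mathbb{F}}_{\mathfrak{d},\mathfrak{d}}\ne0$ for all $\mathfrak{d}\in\Gamma_{\mathrm{sstd}}$. Then $\Theta^{\mathbb{F}}_{\mathrm{sstd}}=\{\hat\vartheta^{\mathbb{F}}_{\mathfrak{d}}:\mathfrak{d}\in\Gamma_{\mathrm{sstd}}\}$ is linearly independent.
   Context: $\mathfrak{S}_n$ is the symmetric group on $\{1,\dots,n\}$ with product given by composition of functions; $n\ge1$. A composition is a finite sequence of positive integers (the empty one, $\varnothing$, is the composition of $0$); $|\lambda|$ is the sum of the parts, $\ell(\lambda)$ the number of parts; a partition is a weakly decreasing composition. A bicomposition $(\alpha|\beta)$ of $n$ is a pair of compositions with $|\alpha|+|\beta|=n$. For a composition $\mu$ of $m$, $\mathfrak{S}_\mu\le\mathfrak{S}_m$ is the Young subgroup of permutations preserving each of the consecutive blocks of sizes $\mu_1,\mu_2,\dots$ of $\{1,\dots,m\}$. For $\xi\in\mathfrak{S}_m$ and $k\ge0$, $\xi^{+k}$ is the permutation of $\{k+1,\dots,k+m\}$ with $\xi^{+k}(x+k)=\xi(x)+k$ (extended by the identity). $\mathfrak{S}_{\alpha|\beta}=\mathfrak{S}_\alpha\mathfrak{S}_\beta^{+|\alpha|}\cong\mathfrak{S}_\alpha\times\mathfrak{S}_\beta$. Tableaux: $[\lambda]=\{(i,j):1\le i\le\ell(\lambda),1\le j\le\lambda_i\}$. A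 $\lambda$-tableau is a bijection $\mathfrak{t}\colon[\lambda]\to\{1,\dots,n\}$. $R_{\mathfrak{t}}$ (resp. $C_{\mathfrak{t}}$) $\le\mathfrak{S}_n$ is the subgroup of permutations preserving the set of entries of each row (resp. column) of $\mathfrak{t}$. A $\lambda$-tableau of type $(\alpha|\beta)$ is a function $\mathrm{T}\colon[\lambda]\to\{\mathbf{c}_1,\dots,\mathbf{c}_{\ell(\alpha)},\mathbf{d}_1,\dots,\mathbf{d}_{\ell(\beta)}\}$ taking the value $\mathbf{c}_i$ exactly $\alpha_i$ times and $\mathbf{d}_j$ exactly $\beta_j$ times. Colours are ordered $\mathbf{c}_1<\mathbf{c}_2<\cdots<\mathbf{d}_1<\mathbf{d}_2<\cdots$. $\mathrm{T}$ is semistandard if rows and columns are weakly increasing, equal entries in distinct nodes of the same row occur only for colours $\mathbf{c}_k$, and equal entries in distinct nodes of the same column occur only for colours $\mathbf{d}_k$; $\mathcal{T}_{\mathrm{sstd}}(\lambda,(\alpha|\beta))$ is the set of these. Fix a $\lambda$-tableau $\mathfrak{t}_0$. $\mathrm{T}_0$ is the tableau of type $(\alpha|\beta)$ colouring the nodes labelled $1,\dots,\alpha_1$ by $\mathfrak{t}_0$ with $\mathbf{c}_1$, the next $\alpha_2$ labels with $\mathbf{c}_2$, and so on through $\mathbf{c}_{\ell(\alpha)}$, then $\mathbf{d}_1$ for the next $\beta_1$ labels, etc. $\mathfrak{S}_n$ acts by $\sigma\cdot\mathrm{T}=\mathrm{T}\circ\mathfrak{t}_0^{-1}\circ\sigma^{-1}\circ\mathfrak{t}_0$,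 and $\mathrm{T}_d=d\cdot\mathrm{T}_0$. Fix a left transversal $\Gamma$ of $\mathfrak{S}_{\alpha|\beta}$ in $\mathfrak{S}_n$ (representatives of left cosets) and put $\Gamma_{\mathrm{sstd}}=\{d\in\Gamma:\mathrm{T}_d\in\mathcal{T}_{\mathrm{sstd}}(\lambda,(\alpha|\beta))\}$. Coefficients: $\mathcal{R}=\{d\in\mathfrak{S}_n:d^{-1}R_{\mathfrak{t}_0}d\cap\mathfrak{S}_{\alpha|\beta}\subseteq\mathfrak{S}_\alpha\}$; one has $\Gamma_{\mathrm{sstd}}\subseteq\mathcal{R}$. For $\mathfrak{d}\in\mathcal{R}$ there is a well-defined map $\varepsilon_{\mathfrak{d}}\colon R_{\mathfrak{t}_0}\mathfrak{d}\mathfrak{S}_{\alpha|\beta}\to\{\pm1\}$, $\varepsilon_{\mathfrak{d}}(\tau\mathfrak{d}\xi_\alpha\xi_\beta^{+|\alpha|})=\mathrm{sgn}(\xi_\beta)$ ($\tau\in R_{\mathfrak{t}_0}$, $(\xi_\alpha,\xi_\beta)\in\mathfrak{S}_\alpha\times\mathfrak{S}_\beta$). For $d\in\mathfrak{S}_n$, $\mathfrak{a}_{d,\mathfrak{d}}=\sum\mathrm{sgn}(\sigma)\varepsilon_{\mathfrak{d}}(\sigma d)\in\mathbb{Z}$, the sum over $\sigma\in C_{\mathfrak{t}_0}$ with $\sigma d\in R_{\mathfrak{t}_0}\mathfrak{d}\mathfrak{S}_{\alpha|\beta}$. For $k\in\mathbb{Z}$, $k^{\mathbb{F}}=k\cdot1_{\mathbb{F}}$;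 thus $\mathfrak{a}^{\mathbb{F}}_{d,\mathfrak{d}}$ is the image of $\mathfrak{a}_{d,\mathfrak{d}}$ in $\mathbb{F}$. Modules, for $\mathcal{O}=\mathbb{Z}$ or a field: $M^\lambda_{\mathcal{O}}$ is the permutation $\mathcal{O}\mathfrak{S}_n$-module on $\mathfrak{S}_n/\mathfrak{S}_\lambda$; with $\mathfrak{t}^\lambda(i,j)=\lambda_1+\dots+\lambda_{i-1}+j$ and $d_{\mathfrak{t}}=\mathfrak{t}\circ(\mathfrak{t}^\lambda)^{-1}$, $e_{\mathfrak{t}}=\sum_{\sigma\in C_{\mathfrak{t}}}\mathrm{sgn}(\sigma)\sigma d_{\mathfrak{t}}\mathfrak{S}_\lambda$; $S^\lambda_{\mathcal{O}}$ is the $\mathcal{O}$-span of all $e_{\mathfrak{t}}$. $M_{\mathcal{O}}(\alpha|\beta)=\mathrm{Ind}_{\mathfrak{S}_\alpha\times\mathfrak{S}_\beta}^{\mathfrak{S}_n}(\mathcal{O}\boxtimes\mathrm{sgn})$ (identifying $\mathfrak{S}_\alpha\times\mathfrak{S}_\beta$ with $\mathfrak{S}_{\alpha|\beta}$) has basis $\{d\otimes1\otimes\epsilon:d\in\Gamma\}$, with $\sigma\cdot(x\otimes1\otimes\epsilon)=\sigma x\otimes1\otimes\epsilon$ and $x\xi_\alpha\xi_\beta^{+|\alpha|}\otimes1\otimes\epsilon=\mathrm{sgn}(\xi_\beta)(x\otimes1\otimes\epsilon)$. Homomorphisms: for $\mathfrak{d}\in\mathcal{R}$ there is a $\mathbb{Z}\mathfrak{S}_n$-homomorphism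 $\hat\vartheta_{\mathfrak{d}}\colon S^\lambda_{\mathbb{Z}}\to M_{\mathbb{Z}}(\alpha|\beta)$ with $\hat\vartheta_{\mathfrak{d}}(e_{\mathfrak{t}})=\sum_{d\in\Gamma}\mathfrak{a}_{\rho_{\mathfrak{t}}^{-1}d,\mathfrak{d}}(d\otimes1\otimes\epsilon)$, where $\rho_{\mathfrak{t}}=\mathfrak{t}\circ\mathfrak{t}_0^{-1}$; $\hat\vartheta^{\mathbb{F}}_{\mathfrak{d}}\colon S^\lambda_{\mathbb{F}}\to M_{\mathbb{F}}(\alpha|\beta)$ is the induced $\mathbb{F}\mathfrak{S}_n$-homomorphism $\hat\vartheta^{\mathbb{F}}_{\mathfrak{d}}(e_{\mathfrak{t}})=\sum_{d\in\Gamma}\mathfrak{a}^{\mathbb{F}}_{\rho_{\mathfrak{t}}^{-1}d,\mathfrak{d}}(d\otimes1\otimes\epsilon)$. *)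

(* Defs.v *)
From HB Require Import structures.
From mathcomp Require Import all_boot all_order all_algebra all_fingroup.

Set Implicit Arguments.
Unset Strict Implicit.
Unset Printing Implicit Defensive.

Import GRing.Theory.
Local Open Scope ring_scope.

(* All labels, row, column and part indices are shifted to start at 0:        *)
(* {1, ..., n} becomes 'I_n, and (i, j) with 1 <= j <= lambda_i becomes       *)
(* i < size la and j < nth 0 la i.                                            *)

Definition is_composition (mu : seq nat) : bool := 0%N \notin mu.

Structure intpart (n : nat) := Intpart {
  intpart_val :> seq nat;
  intpart_comp : is_composition intpart_val;
  intpart_sorted : sorted geq intpart_val;
  intpart_sum : sumn intpart_val = n
}.

Structure bicomp (n : nat) := Bicomp {
  bleft : seq nat;
  bright : seq nat;
  bleft_comp : is_composition bleft;
  bright_comp : is_composition bright;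
  bicomp_sum : (sumn bleft + sumn bright = n)%N
}.

(* Composition of functions. The product of mathcomp permutations is the      *)
(* opposite one: (s * t)%g x = t (s x).                                       *)
Definition pcomp (n : nat) (s t : 'S_n) : 'S_n := (t * s)%g.
Notation "s \cp t" := (pcomp s t) (at level 40, left associativity).

Lemma pcompE n (s t : 'S_n) x : (s \cp t) x = s (t x).
Proof. exact: permM. Qed.

(* x H for the product \cp; in terms of mathcomp's own product this is the    *)
(* right coset H :* x.                                                        *)
Definition lcos n (x : 'S_n) (H : {set 'S_n}) : {set 'S_n} :=
  [set x \cp h | h in H].
Definition lcoss n (H : {set 'S_n}) : {set {set 'S_n}} :=
  [set lcos x H | x in [set: 'S_n]].

Definition left_transversal n (H Gamma : {set 'S_n}) : bool :=
  is_transversal Gamma (lcoss H) [set: 'S_n].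

(* The i-th of the consecutive blocks of sizes mu_0, mu_1, ... of the         *)
(* interval [k, k + |mu|[.                                                    *)
Definition block n (k : nat) (mu : seq nat) (i : nat) : {set 'I_n} :=
  [set x : 'I_n | (k <= x)%N && (reshape_index mu (x - k) == i)].

(* The image of the Young subgroup S_mu in 'S_n under xi |-> xi^{+k}. The     *)
(* sign of xi^{+k} in 'S_n is the sign of xi.                                 *)
Definition young n (k : nat) (mu : seq nat) : {set 'S_n} :=
  ((\bigcap_(i < size mu) 'N(block n k mu i | 'P)) :&:
   'C([set x : 'I_n | ~~ (k <= x < k + sumn mu)%N] | 'P))%g.

Section Tableaux.

Variable la : seq nat.

Definition node : Type := {i : 'I_(size la) & 'I_(nth 0%N la i)}.
HB.instance Definition _ := Finite.on node.

Definition nrow (x : node) : nat := tag x.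
Definition ncol (x : node) : nat := tagged x.

Variable n : nat.

Structure tableau := Tableau {
  tab_val :> {ffun node -> 'I_n};
  tab_bij : injectiveb tab_val && [forall k, k \in codom tab_val]
}.

HB.instance Definition _ := [isSub for tab_val].
HB.instance Definition _ := [Finite of tableau by <:].

Implicit Types t u : tableau.

Lemma tab_inj t : injective t.
Proof. by apply/injectiveP; case/andP: (tab_bij t). Qed.

Lemma tab_codom t k : k \in codom t.
Proof. by case/andP: (tab_bij t) => _ /forallP. Qed.

Definition tab_inv t (k : 'I_n) : node := iinv (tab_codom t k).

Lemma tab_invK t : cancel (tab_inv t) t.
Proof. by move=> k; rewrite /tab_inv f_iinv. Qed.

Lemma tabK t : cancel t (tab_inv t).
Proof. by move=> x; apply: (@tab_inj t); rewrite tab_invK. Qed.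

Lemma tab_perm_inj t u : injective (fun k => t (tab_inv u k)).
Proof. by move=> k l /tab_inj /(can_inj (tab_invK u)). Qed.

(* t o u^-1 *)
Definition tab_perm t u : 'S_n := perm (@tab_perm_inj t u).

Definition rowstab t : {set 'S_n} :=
  (\bigcap_(i < size la) 'N([set t x | x : node & nrow x == i] | 'P))%g.

(* For a partition la the columns are those with index j < la_0. *)
Definition colstab t : {set 'S_n} :=
  (\bigcap_(j < head 0%N la) 'N([set t x | x : node & ncol x == j] | 'P))%g.

End Tableaux.

Section Initial.

Variables (n : nat) (la : intpart n).

Lemma tlam_subproof (x : node la) :
  (flatten_index la (nrow x) (ncol x) < n)%N.
Proof.
rewrite -[X in (_ < X)%N](intpart_sum la); case: x => i j; rewrite /nrow /ncol /=.
have E : sumn la = (sumn (take i la) + sumn (drop i la))%N.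
  by rewrite -sumn_cat cat_take_drop.
rewrite /flatten_index E ltn_add2l (drop_nth 0%N) ?ltn_ord //=.
exact: leq_trans (ltn_ord j) (leq_addr _ _).
Qed.

Definition tlam_fun : {ffun node la -> 'I_n} :=
  [ffun x => Ordinal (tlam_subproof x)].

Lemma tlam_bij : injectiveb tlam_fun && [forall k, k \in codom tlam_fun].
Proof.
apply/andP; split.
  apply/injectiveP => -[i j] [i' j']; rewrite !ffunE => /(congr1 val) /=.
  rewrite /nrow /ncol /= => E.
  have Ei : i = i'.
    apply: val_inj => /=.
    by rewrite -(@flatten_indexKl la i j) // E flatten_indexKl.
  case: _ / Ei j' E => j' E; congr (Tagged _ _); apply: val_inj => /=.
  by rewrite -(@flatten_indexKr la i j) // E flatten_indexKr.
apply/forallP => k; have kn : (k < sumn la)%N by rewrite intpart_sum.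
have hi : (reshape_index la k < size la)%N by rewrite reshape_indexP.
have hj : (reshape_offset la k < nth 0%N la (Ordinal hi))%N.
  exact: reshape_offsetP.
apply/codomP; exists (Tagged (fun i : 'I_(size la) => 'I_(nth 0%N la i)) (Ordinal hj)).
by apply: val_inj; rewrite ffunE /= /nrow /ncol /= reshape_indexK.
Qed.

Definition tlam : tableau la n := Tableau tlam_bij.

End Initial.

Section Colours.

Variables (n : nat) (la : intpart n) (ab : bicomp n) (t0 : tableau la n).
Local Notation al := (bleft ab).
Local Notation be := (bright ab).

(* The colours c_i are encoded by i < size al and the colours d_j by          *)
(* size al + j, so that the order on colours is the order on indices.         *)
Definition colour : Type := 'I_(size al + size be).
HB.instance Definition _ := Finite.on colour.

Definition ctableau : Type := {ffun node la -> colour}.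

Definition of_type (T : ctableau) : bool :=
  [forall i : 'I_(size al), #|[set x | T x == lshift (size be) i]| == nth 0%N al i]
  && [forall j : 'I_(size be), #|[set x | T x == rshift (size al) j]| == nth 0%N be j].

Definition semistandard (T : ctableau) : bool :=
  [forall x, forall y,
     [&& (nrow x == nrow y) && (ncol x <= ncol y)%N ==> (T x <= T y)%N,
         (ncol x == ncol y) && (nrow x <= nrow y)%N ==> (T x <= T y)%N,
         [&& x != y, nrow x == nrow y & T x == T y] ==> (T x < size al)%N
       & [&& x != y, ncol x == ncol y & T x == T y] ==> (size al <= T x)%N]].

Definition Tsstd : {pred ctableau} := [pred T | of_type T && semistandard T].

Lemma label_colour_subproof (k : 'I_n) :
  (reshape_index (al ++ be) k < size al + size be)%N.
Proof.
rewrite -size_cat reshape_indexP // sumn_cat.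
by rewrite bicomp_sum ltn_ord.
Qed.

Definition T0 : ctableau :=
  [ffun x => Ordinal (label_colour_subproof (t0 x))].

Definition ctab_act (s : 'S_n) (T : ctableau) : ctableau :=
  [ffun x => T (tab_inv t0 ((s^-1)%g (t0 x)))].

Definition Tcol (d : 'S_n) : ctableau := ctab_act d T0.

Definition Sal : {set 'S_n} := young n 0 al.
Definition Sbe : {set 'S_n} := young n (sumn al) be.
Definition Sab : {set 'S_n} := [set xa \cp xb | xa in Sal, xb in Sbe].

(* For z = xa \cp xb in Sab this is the parity of xb, see [odd_beta_cp].      *)
Definition odd_beta (z : 'S_n) : bool :=
  restr_perm [set k : 'I_n | (sumn al <= k)%N] z.

Definition Gamma_sstd (Gamma : {set 'S_n}) : {set 'S_n} :=
  [set d in Gamma | Tcol d \in Tsstd].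

Definition calR : {set 'S_n} :=
  [set d | [set d^-1%g \cp r \cp d | r in rowstab t0] :&: Sab \subset Sal].

Definition dcoset (d : 'S_n) : {set 'S_n} :=
  [set r \cp d \cp z | r in rowstab t0, z in Sab].

(* Set to 0 outside the double coset; see [eps_wd] for the independence of    *)
(* the decomposition when d \in calR.                                         *)
Definition eps (d y : 'S_n) : int :=
  if [pick r in rowstab t0 | (r \cp d)^-1%g \cp y \in Sab] is Some r
  then (-1) ^+ odd_beta ((r \cp d)^-1%g \cp y) else 0.

Definition acoef (d dd : 'S_n) : int :=
  \sum_(s in colstab t0 | s \cp d \in dcoset dd) (-1) ^+ s * eps dd (s \cp d).

End Colours.

Section Modules.

Variables (F : fieldType) (n : nat) (la : intpart n) (ab : bicomp n).
Variables (t0 : tableau la n) (Gamma : {set 'S_n}).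

Definition Sla : {set 'S_n} := young n 0 la.
Definition Mla : Type := {ffun {C : {set 'S_n} | C \in lcoss Sla} -> F^o}.
HB.instance Definition _ := GRing.Lmodule.on Mla.
HB.instance Definition _ := Vector.on Mla.

Definition cosvec (X : {set 'S_n}) : Mla := [ffun C => (val C == X)%:R].

Definition Mla_act (s : 'S_n) (v : Mla) : Mla :=
  \sum_C v C *: cosvec [set s \cp y | y in val C].

Definition polytabloid (t : tableau la n) : Mla :=
  \sum_(s in colstab t) (-1) ^+ s *: cosvec (lcos (s \cp tab_perm t (tlam la)) Sla).

Definition specht : {vspace Mla} :=
  <<[seq polytabloid t | t : tableau la n]>>%VS.

(* The induced module M(alpha|beta), in the basis d (x) 1 (x) epsilon, d in   *)
(* Gamma. [tens x] is x (x) 1 (x) epsilon: sgn(xi_beta) times the basis       *)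
(* vector of d when x = d xi_alpha xi_beta^{+|alpha|} with d in Gamma; see    *)
(* [tens_basis], [tens_SabM] and [Mab_act_tens].                              *)
Definition Mab : Type := {ffun {d : 'S_n | d \in Gamma} -> F^o}.
HB.instance Definition _ := GRing.Lmodule.on Mab.
HB.instance Definition _ := Vector.on Mab.

Definition tens (x : 'S_n) : Mab :=
  [ffun d => if (val d)^-1%g \cp x \in Sab ab
             then (-1) ^+ odd_beta ab ((val d)^-1%g \cp x) else 0].

Definition Mab_act (s : 'S_n) (v : Mab) : Mab :=
  \sum_d v d *: tens (s \cp val d).

Definition is_FSn_hom (f : 'Hom(subvs_of specht, Mab)) : Prop :=
  forall (s : 'S_n) (v w : subvs_of specht),
    vsval w = Mla_act s (vsval v) -> f w = Mab_act s (f v).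

(* For dd in calR, the F S_n-homomorphism Mla -> Mab sending d_{t0} S_la to   *)
(*   sum_(d in Gamma, d in R_{t0} dd Sab) eps_dd(d) (d (x) 1 (x) epsilon);    *)
(* hattheta is its restriction to the Specht module. By [hattheta_hom] and    *)
(* [hattheta_polytabloid], hattheta is the (unique, as the e_t span the       *)
(* Specht module) F S_n-homomorphism whose value at e_t is                    *)
(*   sum_(d in Gamma) acoef (rho_t^-1 d) dd (d (x) 1 (x) epsilon).            *)
Definition theta_cos (dd x : 'S_n) : Mab :=
  \sum_(d in Gamma)
     (eps ab t0 dd (tab_perm t0 (tlam la) \cp x^-1%g \cp d))%:~R *: tens d.

Definition theta_fun (dd : 'S_n) (v : Mla) : Mab :=
  \sum_C v C *: theta_cos dd (repr (val C)).

Definition hattheta (dd : 'S_n) : 'Hom(subvs_of specht, Mab) :=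
  linfun (fun v : subvs_of specht => theta_fun dd (vsval v)).

End Modules.

Section Facts.

Variables (n : nat) (la : intpart n) (ab : bicomp n).
Local Notation al := (bleft ab).
Local Notation be := (bright ab).

Canonical young_group k mu := Eval hnf in [group of young n k mu].
Canonical rowstab_group (t : tableau la n) := Eval hnf in [group of rowstab t].
Canonical colstab_group (t : tableau la n) := Eval hnf in [group of colstab t].

Lemma young_out k mu (x : 'S_n) (i : 'I_n) :
  x \in young n k mu -> ~~ (k <= i < k + sumn mu)%N -> x i = i.
Proof.
by case/setIP => _ /astabP/(_ i) H Hi; apply: H; rewrite inE.
Qed.

Local Notation B := [set k : 'I_n | (sumn al <= k)%N].

Lemma Sal_fix x (i : 'I_n) : x \in Sal ab -> (sumn al <= i)%N -> x i = i.
Proof. by move=> Hx Hi; apply: (young_out Hx); rewrite /= add0n -leqNgt. Qed.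

Lemma Sbe_fix x (i : 'I_n) : x \in Sbe ab -> (i < sumn al)%N -> x i = i.
Proof.
move=> Hx Hi; apply: (young_out Hx); by apply: contraL Hi => /andP[]; rewrite -leqNgt.
Qed.

Lemma Sal_C x : x \in Sal ab -> x \in 'C(B | 'P)%g.
Proof. by move=> Hx; apply/astabP => i; rewrite inE => Hi; exact: Sal_fix Hx Hi. Qed.

Lemma Sbe_C x : x \in Sbe ab -> x \in 'C(~: B | 'P)%g.
Proof.
move=> Hx; apply/astabP => i; rewrite !inE -ltnNge => Hi; exact: Sbe_fix Hx Hi.
Qed.

Lemma Sal_N x : x \in Sal ab -> x \in 'N(B | 'P)%g.
Proof. by move/Sal_C; apply/subsetP/astab_sub. Qed.

Lemma Sbe_N x : x \in Sbe ab -> x \in 'N(B | 'P)%g.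
Proof. by move/Sbe_C => H; rewrite -astabsC; apply: subsetP H; apply/astab_sub. Qed.

Lemma Sal_Sbe_commute xa xb : xa \in Sal ab -> xb \in Sbe ab ->
  xa \cp xb = xb \cp xa.
Proof.
move=> Ha Hb; apply/permP => i; rewrite !pcompE.
have [Hi|Hi] := leqP (sumn al) i.
  have := astabs_act i (Sbe_N Hb); rewrite !inE Hi /= => Hxi.
  by rewrite (Sal_fix Ha Hi) (Sal_fix Ha Hxi).
have := astabs_act i (Sal_N Ha); rewrite !inE [X in _ = X]leqNgt Hi /= => /negbT.
by rewrite -ltnNge => Hxi; rewrite (Sbe_fix Hb Hi) (Sbe_fix Hb Hxi).
Qed.

Lemma odd_beta_cp xa xb : xa \in Sal ab -> xb \in Sbe ab ->
  odd_beta ab (xa \cp xb) = xb.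
Proof.
move=> Ha Hb; rewrite /odd_beta /pcomp morphM /= ?(Sal_N Ha) ?(Sbe_N Hb) //.
have -> : restr_perm B xa = 1%g.
  by apply/mker; rewrite ker_restr_perm; exact: Sal_C Ha.
rewrite mulg1; congr odd_perm; apply/permP => i.
have [Hi|Hi] := boolP (i \in B); first by rewrite restr_permE ?Sbe_N.
rewrite (out_perm (restr_perm_on _ _) Hi).
by move: Hi; rewrite inE -ltnNge => Hi; rewrite (Sbe_fix Hb Hi).
Qed.

Lemma Sab_mul : Sab ab = (Sal ab * Sbe ab)%g.
Proof.
apply/setP => x; apply/imset2P/mulsgP => -[xa xb Ha Hb ->].
  by exists xa xb; rewrite // Sal_Sbe_commute.
by exists xa xb; rewrite // Sal_Sbe_commute.
Qed.

Lemma Sab_group_set : group_set (Sab ab).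
Proof.
have -> : Sab ab = (young_group 0 al <*> young_group (sumn al) be)%G.
  rewrite /= comm_joingE -?Sab_mul //.
  apply: normC; apply: cents_norm.
  apply/centsP => xa Ha xb Hb.
  exact/esym/(Sal_Sbe_commute Ha Hb).
exact: groupP.
Qed.
Canonical Sab_group := Group Sab_group_set.

Lemma Sal_Sab x : x \in Sal ab -> x \in Sab ab.
Proof. by move=> Hx; apply/imset2P; exists x 1%g; rewrite ?group1 // /pcomp mul1g. Qed.

Lemma odd_beta_Sal x : x \in Sal ab -> odd_beta ab x = false.
Proof.
move=> Hx; have -> : x = x \cp 1%g by rewrite /pcomp mul1g.
by rewrite odd_beta_cp ?odd_perm1 // group1.
Qed.

Lemma Sab_N x : x \in Sab ab -> x \in 'N(B | 'P)%g.
Proof. by case/imset2P => xa xb Ha Hb ->; rewrite groupM ?(Sal_N Ha) ?(Sbe_N Hb). Qed.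

Lemma odd_betaM x y : x \in Sab ab -> y \in Sab ab ->
  odd_beta ab (x \cp y) = odd_beta ab x (+) odd_beta ab y.
Proof.
by move=> Hx Hy; rewrite /odd_beta /pcomp morphM ?Sab_N //= odd_permM addbC.
Qed.

Variable t0 : tableau la n.

Lemma eps_wd dd r z : dd \in calR ab t0 -> r \in rowstab t0 -> z \in Sab ab ->
  eps ab t0 dd (r \cp dd \cp z) = (-1) ^+ odd_beta ab z.
Proof.
rewrite inE => /subsetP Hdd Hr Hz; rewrite /eps; case: pickP => [r' /andP[Hr' H]|].
  set g := (dd^-1 \cp (r'^-1 \cp r) \cp dd)%g.
  have E : ((r' \cp dd)^-1 \cp (r \cp dd \cp z))%g = g \cp z.
    by rewrite /g /pcomp !invMg !mulgA.
  rewrite E in H *.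
  have Hg : g \in Sab ab by move: H; rewrite groupMl.
  have Hga : g \in Sal ab.
    by apply: Hdd; rewrite inE Hg andbT; apply: imset_f; rewrite groupM ?groupV.
  by rewrite odd_betaM // odd_beta_Sal.
move/(_ r); rewrite Hr /=.
by have -> : ((r \cp dd)^-1 \cp (r \cp dd \cp z) = z)%g; rewrite ?Hz // /pcomp mulgK.
Qed.

Lemma eps_out dd y : y \notin dcoset ab t0 dd -> eps ab t0 dd y = 0.
Proof.
move=> Hy; rewrite /eps; case: pickP => // r /andP[Hr Hz].
case/negP: Hy; apply/imset2P; exists r ((r \cp dd)^-1%g \cp y) => //.
by rewrite /pcomp mulgKV.
Qed.

Lemma dcoset_rowM dd r y : r \in rowstab t0 ->
  (r \cp y \in dcoset ab t0 dd) = (y \in dcoset ab t0 dd).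
Proof.
move=> Hr; apply/imset2P/imset2P => -[r' z Hr' Hz E].
  exists (r^-1 \cp r')%g z; rewrite ?groupM ?groupV //.
  by rewrite -(mulgK r y) -[(y * r)%g]/(r \cp y) E /pcomp !mulgA.
by exists (r \cp r') z; rewrite ?groupM // E /pcomp !mulgA.
Qed.

Lemma dcoset_SabM dd y z : z \in Sab ab ->
  (y \cp z \in dcoset ab t0 dd) = (y \in dcoset ab t0 dd).
Proof.
move=> Hz; apply/imset2P/imset2P => -[r' z' Hr' Hz' E].
  exists r' (z' \cp z^-1)%g; rewrite ?groupM ?groupV //.
  by rewrite -(mulKg z y) -[(z * y)%g]/(y \cp z) E /pcomp !mulgA.
by exists r' (z' \cp z); rewrite ?groupM // E /pcomp !mulgA.
Qed.

Lemma eps_rowM dd r y : dd \in calR ab t0 -> r \in rowstab t0 ->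
  eps ab t0 dd (r \cp y) = eps ab t0 dd y.
Proof.
move=> Hdd Hr; have [Hy|Hy] := boolP (y \in dcoset ab t0 dd); last first.
  by rewrite !eps_out // dcoset_rowM.
case/imset2P: Hy => r' z Hr' Hz ->.
have -> : r \cp (r' \cp dd \cp z) = r \cp r' \cp dd \cp z by rewrite /pcomp !mulgA.
by rewrite !eps_wd // groupM.
Qed.

Lemma eps_SabM dd y z : dd \in calR ab t0 -> z \in Sab ab ->
  eps ab t0 dd (y \cp z) = eps ab t0 dd y * (-1) ^+ odd_beta ab z.
Proof.
move=> Hdd Hz; have [Hy|Hy] := boolP (y \in dcoset ab t0 dd); last first.
  by rewrite !eps_out ?mul0r // dcoset_SabM.
case/imset2P: Hy => r' z' Hr' Hz' ->.
have -> : r' \cp dd \cp z' \cp z = r' \cp dd \cp (z' \cp z) by rewrite /pcomp !mulgA.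
by rewrite !eps_wd ?groupM // odd_betaM // signr_addb.
Qed.

Lemma acoefE d dd :
  acoef ab t0 d dd = \sum_(s in colstab t0) (-1) ^+ s * eps ab t0 dd (s \cp d).
Proof.
rewrite [RHS](bigID (fun s => s \cp d \in dcoset ab t0 dd)) /=.
rewrite [X in _ = _ + X]big1 ?addr0 // => s /andP[_ H]; by rewrite eps_out ?mulr0.
Qed.

Lemma reshape_index_catr (s1 s2 : seq nat) j :
  (sumn s1 <= j)%N -> (j - sumn s1 < sumn s2)%N ->
  reshape_index (s1 ++ s2) j = (size s1 + reshape_index s2 (j - sumn s1))%N.
Proof.
move=> H1 H2; set r := reshape_index s2 _.
pose c := reshape_offset s2 (j - sumn s1).
have Hr : (r < size s2)%N by exact: reshape_indexP.
have Hc : (c < nth 0%N s2 r)%N by exact: reshape_offsetP.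
have -> : j = flatten_index (s1 ++ s2) (size s1 + r) c.
  rewrite /flatten_index take_cat ltnNge leq_addr addKn sumn_cat -addnA.
  by rewrite -[X in (_ + X)%N]/(flatten_index s2 r c) reshape_indexK subnKC.
by rewrite flatten_indexKl // nth_cat [X in if X then _ else _]ltnNge leq_addr addKn.
Qed.

Lemma rowstab_row (t : tableau la n) r k : r \in rowstab t ->
  nrow (tab_inv t (r k)) = nrow (tab_inv t k).
Proof.
move=> /bigcapP Hr; set x := tab_inv t k.
have /(_ isT) H := Hr (tag x) _.
have Hk : k \in [set t x0 | x0 : node la & nrow x0 == tag x].
  by apply/imsetP; exists x; rewrite ?inE // tab_invK.
have := astabs_act k H; rewrite Hk /= => /imsetP[x' Hx' E].
have {}E : r k = t x' by [].
by rewrite E tabK; move: Hx'; rewrite inE => /eqP.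
Qed.

Lemma Gamma_sstd_calR (Gamma : {set 'S_n}) :
  Gamma_sstd ab t0 Gamma \subset calR ab t0.
Proof.
apply/subsetP => d; rewrite !inE => /andP[_ /andP[_ Hss]].
apply/subsetP => g /setIP[/imsetP[r Hr ->{g}]].
set g := (_ \cp d); case/imset2P => xa xb Ha Hb E.
suff E1 : xb = 1%g by rewrite E E1 /pcomp mul1g.
apply/permP => j; rewrite perm1.
have [Hj|Hj] := ltnP j (sumn al); first exact: Sbe_fix Hb Hj.
have HjB : (sumn al <= xb j)%N.
  by have := astabs_act j (Sbe_N Hb); rewrite !inE Hj.
have Egj : g j = xb j by rewrite E pcompE (Sal_fix Ha).
have Hlt (k : 'I_n) : (sumn al <= k)%N -> (k - sumn al < sumn be)%N.
  by move=> Hk; rewrite ltn_subLR // bicomp_sum.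
pose x := tab_inv t0 (d j); pose x' := tab_inv t0 (r (d j)).
have Erow : nrow x' = nrow x by exact: rowstab_row.
have Edg : r (d j) = d (g j) by rewrite /g !pcompE permKV.
have Tx (k : 'I_n) : val (Tcol ab t0 d (tab_inv t0 (d k))) = reshape_index (al ++ be) k.
  by rewrite !ffunE /= !tab_invK permK.
have ET : Tcol ab t0 d x = Tcol ab t0 d x'.
  apply: val_inj; rewrite /x /x' Edg !Tx Egj !reshape_index_catr ?Hlt //.
  congr addn; apply/esym.
  have Hi : (reshape_index be (j - sumn al) < size be)%N by rewrite reshape_indexP ?Hlt.
  have /setIP[/bigcapP/(_ (Ordinal Hi) isT) HN _] := Hb.
  have := astabs_act j HN; rewrite !inE /= Hj HjB eqxx /=.
  by move/eqP.
have [Exx|Nxx] := eqVneq x x'.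
  apply: (@perm_inj _ d); rewrite -Egj -Edg -[RHS](tab_invK t0) -/x Exx.
  by rewrite tab_invK.
have := forallP (forallP Hss x) x'; case/and4P => _ _ + _.
rewrite Nxx Erow ET !eqxx /= -ET Tx reshape_index_catr ?Hlt //.
by rewrite ltnNge leq_addr.
Qed.

End Facts.

Lemma tab_perm_comp (la : seq nat) n (t u v : tableau la n) :
  tab_perm t u \cp tab_perm u v = tab_perm t v.
Proof. by apply/permP => k; rewrite pcompE !permE tabK. Qed.

Lemma tab_permV (la : seq nat) n (t u : tableau la n) :
  ((tab_perm t u)^-1)%g = tab_perm u t.
Proof.
apply/permP => k; apply: (@perm_inj _ (tab_perm t u)).
by rewrite permKV !permE tabK tab_invK.
Qed.

Lemma colstab_conj n (la : intpart n) (t u : tableau la n) s :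
  s \in colstab t -> tab_perm u t \cp s \cp tab_perm t u \in colstab u.
Proof.
move/bigcapP => Hs; apply/bigcapP => j _; apply/astabsP => k /=.
have S1 (v : tableau la n) (l : 'I_n) : (l \in [set v x | x : node la & ncol x == j]) =
    (ncol (tab_inv v l) == j).
  apply/imsetP/eqP => [[x]|H].
    by rewrite inE => /eqP Hx ->; rewrite tabK.
  by exists (tab_inv v l); rewrite ?inE ?H // tab_invK.
have := astabs_act (t (tab_inv u k)) (Hs j isT).
by rewrite !S1 tabK /= /aperm !pcompE !permE tabK.
Qed.

Lemma rowstab_tlam n (la : intpart n) : Sla la \subset rowstab (tlam la).
Proof.
apply/subsetP => s /setIP[/bigcapP Hs _]; apply/bigcapP => i _.
apply/astabsP => k /=.
have S1 (l : 'I_n) : (l \in [set tlam la x | x : node la & nrow x == i]) =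
    (l \in block n 0 la i).
  rewrite [RHS]inE /= subn0; apply/imsetP/eqP => [[x]|H].
    rewrite inE => /eqP Hx ->; rewrite ffunE /= flatten_indexKl //.
    by case: {Hx} x => a b; exact: ltn_ord b.
  exists (tab_inv (tlam la) l); last first.
    exact/esym/(tab_invK (tlam la)).
  rewrite inE; set x := tab_inv _ _.
  have E : val l = flatten_index la (nrow x) (ncol x).
    by rewrite -{1}(tab_invK (tlam la) l) ffunE.
  rewrite -H E flatten_indexKl //.
  by case: {E} x => a b; exact: ltn_ord b.
by rewrite !S1; exact: astabs_act (Hs i isT).
Qed.

Lemma rowstab_conj n (la : intpart n) (t u : tableau la n) s :
  s \in rowstab t -> tab_perm u t \cp s \cp tab_perm t u \in rowstab u.
Proof.
move/bigcapP => Hs; apply/bigcapP => j _; apply/astabsP => k /=.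
have S1 (v : tableau la n) (l : 'I_n) : (l \in [set v x | x : node la & nrow x == j]) =
    (nrow (tab_inv v l) == j).
  apply/imsetP/eqP => [[x]|H].
    by rewrite inE => /eqP Hx ->; rewrite tabK.
  by exists (tab_inv v l); rewrite ?inE ?H // tab_invK.
have := astabs_act (t (tab_inv u k)) (Hs j isT).
by rewrite !S1 tabK /= /aperm !pcompE !permE tabK.
Qed.

Lemma transv_ex n (H : {group 'S_n}) (Gamma : {set 'S_n}) x :
  left_transversal H Gamma -> exists2 d, d \in Gamma & (d^-1 \cp x)%g \in H.
Proof.
case/and3P => _ _ /forall_inP /(_ (lcos x H)) Hx.
have /Hx/cards1P[d E] : lcos x H \in lcoss H by apply: imset_f; rewrite inE.
have : d \in Gamma :&: lcos x H by rewrite E set11.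
case/setIP => HG /imsetP[h Hh Ed]; exists d => //.
by rewrite Ed /pcomp invMg mulKVg groupV.
Qed.

Lemma transv_inj n (H : {group 'S_n}) (Gamma : {set 'S_n}) d d' :
  left_transversal H Gamma -> d \in Gamma -> d' \in Gamma ->
  (d^-1 \cp d')%g \in H -> d = d'.
Proof.
case/and3P => _ _ /forall_inP /(_ (lcos d H)) Hx Hd Hd' Hdd'.
have /Hx/cards1P[e E] : lcos d H \in lcoss H by apply: imset_f; rewrite inE.
have : d \in Gamma :&: lcos d H.
  rewrite inE Hd; apply/imsetP; exists 1%g; rewrite ?group1 //.
  by rewrite /pcomp mul1g.
have : d' \in Gamma :&: lcos d H.
  rewrite inE Hd'; apply/imsetP; exists (d^-1 \cp d')%g => //.
  by rewrite /pcomp mulgKV.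
by rewrite E !inE => /eqP -> /eqP ->.
Qed.

Section ModuleFacts.

Variables (F : fieldType) (n : nat) (la : intpart n) (ab : bicomp n).
Variables (t0 : tableau la n) (Gamma : {set 'S_n}).
Hypothesis HG : left_transversal (Sab ab) Gamma.

Local Notation Mab := (Mab F Gamma).
Local Notation Mla := (Mla F la).
Local Notation tens := (tens F ab Gamma).
Local Notation Mab_act := (@Mab_act F n ab Gamma).
Local Notation Mla_act := (@Mla_act F n la).

Lemma tens_SabM x z : z \in Sab ab ->
  tens (x \cp z) = (-1) ^+ odd_beta ab z *: tens x.
Proof.
move=> Hz; apply/ffunP => d; rewrite !ffunE.
have -> : ((val d)^-1 \cp (x \cp z))%g = ((val d)^-1 \cp x)%g \cp z.
  by rewrite /pcomp mulgA.
rewrite groupMl //=; case: ifP => [H|_]; last by rewrite scaler0.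
by rewrite odd_betaM // signr_addb mulrC.
Qed.

Lemma tens_basis (d : {d : 'S_n | d \in Gamma}) :
  tens (val d) = [ffun d' => (d' == d)%:R].
Proof.
apply/ffunP => d'; rewrite !ffunE; case: eqVneq => [->|Nd].
  rewrite /pcomp mulgV group1 odd_beta_Sal //; exact: group1.
case: ifP => // /(transv_inj HG (valP d') (valP d)) /val_inj E.
by rewrite E eqxx in Nd.
Qed.

Lemma tens_coord (v : Mab) : v = \sum_d v d *: tens (val d).
Proof.
apply/ffunP => d; rewrite sum_ffunE (bigD1 d) //= big1 => [|d' Nd].
  by rewrite addr0 ffunE tens_basis ffunE eqxx; rewrite /GRing.scale /= mulr1.
by rewrite ffunE tens_basis ffunE eq_sym (negPf Nd) scaler0.
Qed.

Lemma Mab_act_linear s : linear (Mab_act s).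
Proof.
move=> a u v; rewrite /Mab_act scaler_sumr -big_split /=.
by apply: eq_bigr => d _; rewrite !ffunE scalerDl scalerA.
Qed.
HB.instance Definition _ s :=
  GRing.isLinear.Build F Mab Mab *:%R (Mab_act s) (@Mab_act_linear s).

Lemma Mab_act_tens s x : Mab_act s (tens x) = tens (s \cp x).
Proof.
have H (d : {d : 'S_n | d \in Gamma}) : Mab_act s (tens (val d)) = tens (s \cp val d).
  rewrite /Mab_act (bigD1 d) //= big1 => [|d' Nd].
    by rewrite tens_basis ffunE eqxx scale1r addr0.
  by rewrite tens_basis ffunE (negPf Nd) scale0r.
have [d Hd Hz] := transv_ex x HG; set z := (_ \cp _) in Hz.
have -> : x = d \cp z by rewrite /z /pcomp mulgKV.
have -> : s \cp (d \cp z) = s \cp d \cp z by rewrite /pcomp mulgA.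
by rewrite !(tens_SabM _ Hz) linearZ /= (H (exist _ d Hd)).
Qed.

Lemma theta_cosM dd s x : dd \in calR ab t0 ->
  theta_cos F ab t0 Gamma dd (s \cp x) = Mab_act s (theta_cos F ab t0 Gamma dd x).
Proof.
move=> Hdd; rewrite /theta_cos linear_sum.
pose g y := odflt 1%g [pick d in Gamma | (d^-1 \cp y)%g \in Sab ab].
have gP y : (g y \in Gamma) && ((g y)^-1 \cp y \in Sab ab)%g.
  rewrite /g; case: pickP => //= N; have [d Hd Hz] := transv_ex y HG.
  by have := N d; rewrite Hd Hz.
have gE d y : d \in Gamma -> (d^-1 \cp y)%g \in Sab ab -> g y = d.
  case/andP: (gP y) => Hg Hz Hd Hz'; apply: (transv_inj HG) => //.
  rewrite -groupV in Hz'; have := groupM Hz' Hz.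
  by rewrite /pcomp invMg invgK -mulgA mulKg.
rewrite (reindex_onto (fun d => g (s \cp d)) (fun d => g (s^-1 \cp d)%g)) /=; last first.
  move=> d Hd; apply: gE => //; case/andP: (gP (s^-1 \cp d)%g) => _ H.
  by rewrite -groupV; move: H; rewrite /pcomp !invMg invgK !mulgA.
apply: eq_big => [d|d].
  case/andP: (gP (s \cp d)) => -> /= H.
  apply/eqP/idP => [<-|Hd]; first by case/andP: (gP (s^-1 \cp g (s \cp d))%g).
  apply: gE => //; rewrite -groupV; move: H.
  by rewrite /pcomp !invMg !invgK !mulgA.
move=> _; rewrite linearZ /= Mab_act_tens.
case/andP: (gP (s \cp d)) => _; set z := (_ \cp (s \cp d)) => Hz.
have -> : g (s \cp d) = s \cp d \cp z^-1%g.
  by rewrite /z /pcomp invMg invgK mulgKV.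
clearbody z; set G := tab_perm _ _.
have -> : G \cp ((s \cp x)^-1)%g \cp (s \cp d \cp z^-1)%g =
          G \cp x^-1%g \cp d \cp z^-1%g.
  by rewrite /pcomp invMg !mulgA mulgK.
rewrite eps_SabM ?groupV // tens_SabM ?groupV // scalerA; congr (_ *: _).
by rewrite rmorphM /= rmorph_sign -mulrA -signr_addb addbb mulr1.
Qed.

Lemma theta_cos_rep dd x h : dd \in calR ab t0 -> h \in Sla la ->
  theta_cos F ab t0 Gamma dd (x \cp h) = theta_cos F ab t0 Gamma dd x.
Proof.
move=> Hdd Hh; apply: eq_bigr => d _; congr (_%:~R *: _).
set G := tab_perm _ _.
have Hr : G \cp h^-1%g \cp tab_perm (tlam la) t0 \in rowstab t0.
  by apply: rowstab_conj; rewrite groupV; apply: (subsetP (rowstab_tlam la)).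
rewrite -[RHS](eps_rowM _ Hdd Hr) -(tab_permV t0) -/G; congr eps.
by rewrite /pcomp invMg !mulgA mulgK.
Qed.

Lemma theta_fun_linear dd : linear (theta_fun ab t0 Gamma dd : Mla -> Mab).
Proof.
move=> a u v; rewrite /theta_fun scaler_sumr -big_split /=.
by apply: eq_bigr => d _; rewrite !ffunE scalerDl scalerA.
Qed.
HB.instance Definition _ dd :=
  GRing.isLinear.Build F Mla Mab *:%R (theta_fun ab t0 Gamma dd) (@theta_fun_linear dd).

Lemma theta_fun_cos dd x : dd \in calR ab t0 ->
  theta_fun ab t0 Gamma dd (cosvec F la (lcos x (Sla la)) : Mla) =
  theta_cos F ab t0 Gamma dd x.
Proof.
move=> Hdd; have HC : lcos x (Sla la) \in lcoss (Sla la).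
  by apply: imset_f; rewrite inE.
pose C : {C : {set 'S_n} | C \in lcoss (Sla la)} := exist _ (lcos x (Sla la)) HC.
rewrite /theta_fun (bigD1 C) //= big1 => [|C' NC].
  rewrite addr0 ffunE eqxx scale1r.
  have : repr (lcos x (Sla la)) \in lcos x (Sla la).
    apply: (mem_repr x); apply/imsetP; exists 1%g; first exact: group1.
    by rewrite /pcomp mul1g.
  by case/imsetP => h Hh ->; apply: theta_cos_rep.
by rewrite ffunE -[lcos x _]/(val C) val_eqE (negPf NC) scale0r.
Qed.

Lemma cosvec_coord (v : Mla) : v = \sum_C v C *: cosvec F la (val C).
Proof.
apply/ffunP => d; rewrite sum_ffunE (bigD1 d) //= big1 => [|d' Nd].
  by rewrite addr0 !ffunE eqxx; rewrite /GRing.scale /= mulr1.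
by rewrite !ffunE eq_sym val_eqE (negPf Nd) scaler0.
Qed.

Lemma lcos_act s x (H : {set 'S_n}) :
  [set s \cp y | y in lcos x H] = lcos (s \cp x) H.
Proof.
rewrite /lcos -imset_comp; apply: eq_imset => h /=; by rewrite /pcomp mulgA.
Qed.

Lemma theta_fun_act dd s (v : Mla) : dd \in calR ab t0 ->
  theta_fun ab t0 Gamma dd (Mla_act s v) = Mab_act s (theta_fun ab t0 Gamma dd v).
Proof.
move=> Hdd; have -> : theta_fun ab t0 Gamma dd v =
    \sum_C v C *: theta_fun ab t0 Gamma dd (cosvec F la (val C)).
  rewrite {1}(cosvec_coord v) linear_sum.
  by apply: eq_bigr => C _; rewrite linearZ.
rewrite /Mla_act !linear_sum; apply: eq_bigr => C _; rewrite !linearZ /=.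
congr (_ *: _); case/imsetP: (valP C) => x _ ->.
by rewrite lcos_act !theta_fun_cos // theta_cosM.
Qed.

Lemma hatthetaE dd (v : subvs_of (specht F la)) :
  hattheta F ab t0 Gamma dd v = theta_fun ab t0 Gamma dd (vsval v).
Proof.
have L : linear (fun v : subvs_of (specht F la) => theta_fun ab t0 Gamma dd (vsval v)).
  by move=> a u w; rewrite !linearP.
pose f : {linear subvs_of (specht F la) -> Mab} :=
  HB.pack (fun v : subvs_of (specht F la) => theta_fun ab t0 Gamma dd (vsval v))
    (GRing.isLinear.Build _ _ _ _ _ L).
exact: (lfunE f).
Qed.

Lemma hattheta_hom dd : dd \in calR ab t0 ->
  is_FSn_hom ab (hattheta F ab t0 Gamma dd : 'Hom(subvs_of (specht F la), Mab)).
Proof. by move=> Hdd s v w E; rewrite !hatthetaE E theta_fun_act. Qed.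

Lemma polytabloid_specht (t : tableau la n) : polytabloid F t \in specht F la.
Proof. by apply: memv_span; apply: image_f. Qed.

Lemma hattheta_polytabloid dd (t : tableau la n) : dd \in calR ab t0 ->
  hattheta F ab t0 Gamma dd (vsproj (specht F la) (polytabloid F t)) =
  \sum_(d in Gamma)
     (acoef ab t0 ((tab_perm t t0)^-1%g \cp d) dd)%:~R *: tens d.
Proof.
move=> Hdd; rewrite hatthetaE vsprojK ?polytabloid_specht // linear_sum.
under eq_bigr => s _ do rewrite linearZ /= theta_fun_cos // /theta_cos scaler_sumr.
rewrite exchange_big /=; apply: eq_bigr => d _; rewrite acoefE rmorph_sum scaler_suml.
set r := tab_perm t t0.
rewrite (reindex_onto (fun s => r \cp s^-1%g \cp r^-1%g)
                      (fun s => r^-1 \cp s^-1 \cp r)%g) /=; last first.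
  by move=> s _; rewrite /pcomp !invMg !invgK !mulgA mulVg mul1g mulgKV.
apply: eq_big => [s|s _].
  have -> : (r^-1 \cp (r \cp s^-1 \cp r^-1)^-1 \cp r)%g = s.
    by rewrite /pcomp !invMg !invgK !mulgA mulgV mul1g mulgK.
  rewrite eqxx andbT; apply/idP/idP => [H|].
    rewrite -groupV; have := colstab_conj t0 H; rewrite -(tab_permV t) -/r.
    by rewrite /pcomp !mulgA mulgV mul1g mulgK.
  by rewrite -groupV => /(colstab_conj t); rewrite -(tab_permV t) -/r.
rewrite scalerA; congr (_ *: _).
have -> : ((r \cp s^-1 \cp r^-1)%g : bool) = s.
  by rewrite /pcomp !odd_permM !odd_permV addbC addbK.
rewrite rmorphM /= rmorph_sign; congr (_ * (eps _ _ _ _)%:~R).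
by rewrite -(tab_perm_comp t t0 (tlam la)) -/r /pcomp !invMg !invgK !mulgA mulgKV mulgK.
Qed.

Lemma tab_trans_bij (t : tableau la n) (s : 'S_n) :
  let f := [ffun x => s (t x)] in injectiveb f && [forall k, k \in codom f].
Proof.
apply/andP; split.
  by apply/injectiveP => x y; rewrite !ffunE => /perm_inj /tab_inj.
apply/forallP => k; apply/codomP; exists (tab_inv t (s^-1%g k)).
by rewrite ffunE tab_invK permKV.
Qed.

Lemma Mla_act_linear s : linear (Mla_act s).
Proof.
move=> a u v; rewrite /Mla_act scaler_sumr -big_split /=.
by apply: eq_bigr => d _; rewrite !ffunE scalerDl scalerA.
Qed.
HB.instance Definition _ s :=
  GRing.isLinear.Build F Mla Mla *:%R (Mla_act s) (@Mla_act_linear s).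

Lemma Mla_act_cosvec s x :
  Mla_act s (cosvec F la (lcos x (Sla la))) = cosvec F la (lcos (s \cp x) (Sla la)).
Proof.
have HC : lcos x (Sla la) \in lcoss (Sla la).
  by apply: imset_f; rewrite inE.
pose C : {C : {set 'S_n} | C \in lcoss (Sla la)} := exist _ (lcos x (Sla la)) HC.
rewrite /Mla_act (bigD1 C) //= big1 => [|C' NC].
  by rewrite addr0 ffunE eqxx scale1r lcos_act.
by rewrite ffunE -[lcos x _]/(val C) val_eqE (negPf NC) scale0r.
Qed.

Lemma polytabloid_act s (t : tableau la n) :
  Mla_act s (polytabloid F t) = polytabloid F (Tableau (tab_trans_bij t s)).
Proof.
set u := Tableau _; have Eu : s = tab_perm u t.
  by apply/permP => k; rewrite permE ffunE tab_invK.
rewrite linear_sum.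
under eq_bigr => r _ do rewrite linearZ /= Mla_act_cosvec.
rewrite [RHS](reindex_onto (fun r => s \cp r \cp s^-1%g)
                           (fun r => s^-1%g \cp r \cp s)) /=; last first.
  by move=> r _; rewrite /pcomp !mulgA mulVg mul1g mulgKV.
apply: eq_big => [r|r _].
  have E : s^-1%g \cp (s \cp r \cp s^-1%g) \cp s = r.
    by rewrite /pcomp !mulgA mulgV mul1g mulgK.
  rewrite E eqxx andbT; apply/idP/idP => [H|].
    by rewrite {2}Eu tab_permV {1}Eu; apply: colstab_conj.
  move/(colstab_conj t).
  by rewrite -[tab_perm t u](tab_permV u) -Eu E.
congr ((-1) ^+ _ *: cosvec F la (lcos _ _)).
  by rewrite /pcomp !odd_permM !odd_permV addbC addbK.
by rewrite -(tab_perm_comp u t (tlam la)) -Eu /pcomp !mulgA mulgK.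
Qed.

Lemma specht_stable s v : v \in specht F la -> Mla_act s v \in specht F la.
Proof.
rewrite /specht; set l := image _ _ => Hv.
rewrite (coord_span (X := in_tuple l) Hv) linear_sum.
apply: memv_suml => i _; rewrite linearZ; apply: memvZ.
have /imageP[t _ ->] : (in_tuple l)`_i \in l by apply: mem_nth; exact: ltn_ord.
by rewrite /= polytabloid_act polytabloid_specht.
Qed.

End ModuleFacts.

(* Main.v *)
Require Import Defs.
From HB Require Import structures.
From mathcomp Require Import all_boot all_order all_algebra all_fingroup.

(** Evaluating [hattheta d] at the polytabloid [e_(t0)] reduces the theorem to
    the matrix [a_(d',d)], indexed by [Gamma_sstd], being triangular. If
    [a_(d',d) != 0], then [T_d] is row equivalent to a column permutation of
    [T_d']. As the columns of [T_d'] increase, the number of entries of colour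
    at most [k] in the first [r] rows is then at least as large in [T_d'] as in
    [T_d], for all [r] and [k]. If all these numbers agree, then [T_d] and
    [T_d'] have the same row contents, so they are equal since rows increase. *)

Set Implicit Arguments.
Unset Strict Implicit.
Unset Printing Implicit Defensive.

Import GRing.Theory.
Local Open Scope ring_scope.

(** * A triangularity criterion for linear independence *)

Section TriangularFree.

Variables (K : fieldType) (V : vectType K) (I : finType) (A : {set I}).
Variables (f : I -> V) (phi : I -> V -> K) (w : I -> nat).
Hypothesis phi_scalar : forall i, scalar (phi i).
Hypothesis phi_diag : forall i, i \in A -> phi i (f i) != 0.
Hypothesis phi_triangular : forall i j, i \in A -> j \in A ->
  phi i (f j) != 0 -> (w j <= w i ?= iff (i == j))%N.

(** In a linear relation with a nonzero coefficient, take such an index [i] of least weight and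
    apply [phi i]. A further term with nonzero coefficient that survives would have weight at most
    [w i], hence equal to it by minimality, and its index would then be [i]. So only the diagonal
    term remains, and it is nonzero. *)
Lemma free_image_triangular : free [seq f i | i in A].
Proof.
have -> : [seq f i | i in A] = [tuple of [seq f i | i in A]] :> seq V by [].
apply/freeP => c c0.
have [/forallP cE i|/forallPn /= [i0 ci0]] := boolP [forall i, c i == 0].
  exact/eqP.
have [i ci imin] := @arg_minnP _ i0 (fun i => c i != 0) (w \o enum_val) ci0.
have [p pE] : exists p : {scalar V}, p =1 phi (enum_val i).
  pose p : {scalar V} := HB.pack (phi (enum_val i))
    (GRing.isLinear.Build _ _ _ _ _ (@phi_scalar (enum_val i))).
  by exists p.
have := congr1 p c0; rewrite linear_sum linear0 (bigD1 i) //= big1 => [|j ji].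
  rewrite addr0 scalarZ pE nth_image => /eqP; rewrite mulf_eq0 (negPf ci) /=.
  by rewrite (negPf (phi_diag (enum_valP i))).
rewrite scalarZ pE nth_image; apply/eqP; rewrite mulf_eq0.
apply: contraNT ji; rewrite negb_or => /andP[cj pj].
have wji := phi_triangular (enum_valP i) (enum_valP j) pj.
rewrite eq_sym -(inj_eq enum_val_inj) -(geq_leqif wji).
exact: imin.
Qed.

End TriangularFree.

(** * Counting small entries in the first rows *)

Section RowColumnCounts.

Variables (X : finType) (row col : X -> nat).
Implicit Types (T : X -> nat) (A B C : {set X}).

Definition upper_count T r k := #|[set x | (row x < r)%N && (T x <= k)%N]|.

(** The comparison is made column by column. In column [j] the nodes of the first [r] rows ([Aj])
    and the nodes with entry at most [k] ([Bj]) are both initial segments, so one contains the other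
    and their intersection has the size of the smaller set. Replacing [Bj] by its preimage under [p]
    gives an intersection no larger than either set. *)
Lemma upper_count_max T (p : X -> X) r k :
  injective p -> (forall x, col (p x) = col x) ->
  (forall x y, col x = col y -> (row x <= row y)%N -> (T x <= T y)%N) ->
  (upper_count (T \o p) r k <= upper_count T r k)%N.
Proof.
move=> p_inj pc T_incr; rewrite /upper_count -!sum1_card.
(* The column index is put into a finite type so that the count can be split over it; no column
   index exceeds [m], so no information is lost. *)
pose m := \max_x col x; pose c x : 'I_m.+1 := inord (col x).
have cE x y : c x = c y -> col x = col y.
  by move/(congr1 (@nat_of_ord _)); rewrite !inordK // ltnS leq_bigmax.
rewrite !(partition_big c xpredT) //=; apply: leq_sum => j _; rewrite !sum1_card.
pose Aj := [set x | (row x < r)%N && (c x == j)].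
pose Bj := [set x | (T x <= k)%N && (c x == j)].
have cardE S : #|[pred x in [set x | (row x < r)%N && (S x <= k)%N] | c x == j]| =
    #|Aj :&: [set x | (S x <= k)%N && (c x == j)]|.
  by apply: eq_card => x; rewrite !inE; case: (c x == j); rewrite ?andbT ?andbF.
rewrite !{}cardE -/Bj.
have [AB|/subsetPn[x]] := boolP (Aj \subset Bj).
  by rewrite (setIidPl AB) subset_leq_card // subsetIl.
rewrite !inE => /andP[xr /eqP cx]; rewrite cx eqxx andbT -ltnNge => xk.
have /setIidPr -> : Bj \subset Aj.
  apply/subsetP => y; rewrite !inE => /andP[yk /eqP cy]; rewrite cy eqxx andbT.
  apply: leq_ltn_trans xr; rewrite leqNgt; apply/negP => /ltnW xy.
  by have := T_incr x y (cE _ _ (etrans cx (esym cy))) xy; rewrite leqNgt (leq_ltn_trans yk).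
apply: leq_trans (subset_leq_card (subsetIr _ _)) _.
rewrite -(card_imset _ p_inj) subset_leq_card //.
apply/subsetP => _ /imsetP[x' + ->]; rewrite !inE /= => /andP[-> /eqP <-].
by rewrite /c pc eqxx.
Qed.

Lemma upper_count_row T (q : X -> X) r k :
  injective q -> (forall x, row (q x) = row x) ->
  upper_count (T \o q) r k = upper_count T r k.
Proof.
move=> q_inj qr; rewrite /upper_count -[RHS](card_preimset _ q_inj).
by apply: eq_card => x; rewrite !inE qr.
Qed.

(** Differences of counts for consecutive [r] give the number of entries at most [k] in a single
    row. The nodes carrying them form an initial segment of the row, so equal sizes force equal sets
    [D T r k] and [D T' r k]. Taking [k] to be [T' x] and then [T x] yields both inequalities; hence
    the bounds on [r] and [k]. *)
Lemma upper_count_row_inj T T' M :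
  (forall x y, row x = row y -> (col x <= col y)%N -> (T x <= T y)%N) ->
  (forall x y, row x = row y -> (col x <= col y)%N -> (T' x <= T' y)%N) ->
  (forall x, (row x < M)%N) ->
  (forall r k, (r <= M)%N -> (k <= maxn (\max_x T x) (\max_x T' x))%N ->
     upper_count T r k = upper_count T' r k) ->
  T =1 T'.
Proof.
move=> T_incr T'_incr rowM TT'.
pose D S r k := [set x | (row x == r) && (S x <= k)%N].
have countS S r k : upper_count S r.+1 k = (upper_count S r k + #|D S r k|)%N.
  rewrite /upper_count -cardsUI.
  have -> : [set x | (row x < r)%N && (S x <= k)%N] :&: D S r k = set0.
    by apply/setP => x; rewrite !inE; case: eqVneq => [->|]; rewrite ?ltnn ?andbF.
  rewrite cards0 addn0; apply: eq_card => x; rewrite !inE ltnS leq_eqVlt.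
  by rewrite andb_orl orbC.
have DE r k : (r < M)%N -> (k <= maxn (\max_x T x) (\max_x T' x))%N ->
    D T r k = D T' r k.
  move=> rM kM; have cardD : #|D T r k| = #|D T' r k|.
    have := TT' r.+1 k rM kM; rewrite !countS (TT' _ _ (ltnW rM) kM).
    exact: addnI.
  have [sub|/subsetPn[x]] := boolP (D T r k \subset D T' r k).
    by apply/eqP; rewrite eqEcard sub cardD /=.
  rewrite !inE => /andP[/eqP xr xk]; rewrite xr eqxx /= -ltnNge => xk'.
  apply/eqP; rewrite eq_sym eqEcard cardD leqnn andbT.
  apply/subsetP => y; rewrite !inE => /andP[/eqP yr yk']; rewrite yr eqxx /=.
  apply: leq_trans xk; apply: T_incr; first by rewrite yr.
  rewrite leqNgt; apply/negP => /ltnW xy.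
  have := T'_incr x y (etrans xr (esym yr)) xy.
  by rewrite leqNgt (leq_ltn_trans yk').
move=> x; apply/eqP; rewrite eqn_leq; apply/andP; split.
  have := DE (row x) (T' x) (rowM x); rewrite leq_max leq_bigmax orbT.
  by move=> /(_ isT)/setP/(_ x); rewrite !inE eqxx leqnn.
have := DE (row x) (T x) (rowM x); rewrite leq_max leq_bigmax.
by move=> /(_ isT)/setP/(_ x); rewrite !inE eqxx leqnn.
Qed.

End RowColumnCounts.

(** * The stabiliser of the colouring and the weight of a tableau *)

Section TableauOrder.

Variables (n : nat) (la : intpart n) (ab : bicomp n) (t0 : tableau la n).
Local Notation al := (bleft ab).
Local Notation be := (bright ab).
Local Notation Tc := (Tcol ab t0).

Lemma colstab_col (t : tableau la n) s k : s \in colstab t ->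
  ncol (tab_inv t (s k)) = ncol (tab_inv t k).
Proof.
move=> /bigcapP Hs; set x := tab_inv t k.
(* [colstab] constrains only columns with index below the first part; since the parts of [la]
   decrease, these are all the columns. *)
have xh : (ncol x < head 0%N la)%N.
  apply: leq_trans (ltn_ord (tagged x)) _; rewrite -nth0.
  have := intpart_sorted la; case: (tag x) => i /= ila la_sorted.
  have := sorted_leq_nth (rev_trans leq_trans) leqnn 0%N la_sorted.
  by apply; rewrite ?inE //; apply: leq_ltn_trans ila.
have /(_ isT) H := Hs (Ordinal xh) _.
have Hk : k \in [set t x0 | x0 : node la & ncol x0 == Ordinal xh].
  by apply/imsetP; exists x; rewrite ?inE // tab_invK.
have := astabs_act k H; rewrite Hk /= => /imsetP[x' Hx' E].
have {}E : s k = t x' by [].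
by rewrite E tabK; move: Hx'; rewrite inE => /eqP.
Qed.

Lemma TcolE d x : Tc d x = T0 ab t0 (tab_inv t0 (d^-1%g (t0 x))).
Proof. by rewrite ffunE. Qed.

Lemma Tcol_cp s d x : Tc (s \cp d) x = Tc d (tab_inv t0 (s^-1%g (t0 x))).
Proof. by rewrite !TcolE tab_invK /Defs.pcomp invMg permM. Qed.

Lemma young_block k mu (z : 'S_n) (i : 'I_n) : z \in young n k mu ->
  (k <= i < k + sumn mu)%N ->
  (k <= z i)%N /\ reshape_index mu (z i - k) = reshape_index mu (i - k).
Proof.
case/setIP => /bigcapP zN _ /andP[ki ik].
have im : (reshape_index mu (i - k) < size mu)%N by rewrite reshape_indexP // ltn_subLR.
have := astabs_act i (zN (Ordinal im) isT).
by rewrite !inE /= ki eqxx /= => /andP[-> /eqP].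
Qed.

Lemma reshape_index_catl (s1 s2 : seq nat) j : (j < sumn s1)%N ->
  reshape_index (s1 ++ s2) j = reshape_index s1 j.
Proof.
move=> js1; rewrite -[X in reshape_index (_ ++ _) X](reshape_indexK s1 j).
have r1 := reshape_indexP js1; have o1 := reshape_offsetP js1.
have -> : flatten_index s1 (reshape_index s1 j) (reshape_offset s1 j) =
    flatten_index (s1 ++ s2) (reshape_index s1 j) (reshape_offset s1 j).
  by rewrite /flatten_index takel_cat // ltnW.
by rewrite flatten_indexKl // nth_cat r1.
Qed.

(** The colour classes of labels are the blocks of [al] followed by the shifted blocks of [be]; each
    factor of [z] preserves its own blocks and fixes all other labels. *)
Lemma Sab_colour (z : 'S_n) (i : 'I_n) : z \in Sab ab ->
  reshape_index (al ++ be) (z i) = reshape_index (al ++ be) i.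
Proof.
case/imset2P => xa xb Ha Hb ->; rewrite pcompE.
have [ia|ia] := ltnP i (sumn al).
  rewrite (Sbe_fix Hb ia).
  have := @young_block 0 al xa i Ha; rewrite add0n ia => /(_ isT)[_].
  rewrite !subn0 => E.
  have xia : (xa i < sumn al)%N.
    have := astabs_act i (Sal_N Ha); rewrite !inE => H.
    by rewrite ltnNge; move: ia; rewrite ltnNge -H.
  by rewrite !reshape_index_catl.
have Hlt (k : 'I_n) : (sumn al <= k)%N -> (k - sumn al < sumn be)%N.
  by move=> ak; rewrite ltn_subLR // bicomp_sum.
have [|xi E] := @young_block (sumn al) be xb i Hb.
  by rewrite ia bicomp_sum /=.
by rewrite (Sal_fix Ha xi) !reshape_index_catr ?Hlt // E.
Qed.

Lemma ltn_colour (k : 'I_n) :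
  (reshape_index (al ++ be) k < size al)%N = (k < sumn al)%N.
Proof.
have [ka|ka] := ltnP k (sumn al); first by rewrite reshape_index_catl // reshape_indexP.
rewrite reshape_index_catr //; first by rewrite ltnNge leq_addr.
by rewrite ltn_subLR // bicomp_sum.
Qed.

(** Preserving colours, [z] preserves the set [B] of labels with a colour of the second kind. It is
    therefore the product of its restrictions to the complement of [B] and to [B], which lie in
    [Sal] and [Sbe]. *)
Lemma colour_Sab (z : 'S_n) :
  (forall i, reshape_index (al ++ be) (z i) = reshape_index (al ++ be) i) ->
  z \in Sab ab.
Proof.
move=> zc; pose B := [set k : 'I_n | (sumn al <= k)%N].
have zB (k : 'I_n) : (sumn al <= z k)%N = (sumn al <= k)%N.
  by rewrite [LHS]leqNgt [RHS]leqNgt -!ltn_colour zc.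
have zNB : z \in 'N(B | 'P)%g by apply/astabsP => k; rewrite !inE /= /aperm zB.
have zNCB : z \in 'N(~: B | 'P)%g by rewrite astabsC.
have bE k : restr_perm B z k = if (sumn al <= k)%N then z k else k.
  have [kB|kB] := boolP (k \in B); first by rewrite restr_permE //; rewrite inE in kB; rewrite kB.
  by rewrite (out_perm (restr_perm_on _ _) kB); rewrite inE in kB; rewrite (negPf kB).
have aE k : restr_perm (~: B) z k = if (sumn al <= k)%N then k else z k.
  have [kB|kB] := boolP (k \in ~: B).
    by rewrite restr_permE //; rewrite !inE in kB; rewrite (negPf kB).
  by rewrite (out_perm (restr_perm_on _ _) kB); rewrite !inE negbK in kB; rewrite kB.
apply/imset2P; exists (restr_perm (~: B) z) (restr_perm B z).
- apply/setIP; split.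
    apply/bigcapP => i _; apply/astabsP => k; rewrite !inE /= !subn0 /aperm aE.
    have [//|ka] := leqP (sumn al) k.
    by have := zc k; rewrite !reshape_index_catl // => [->|]; rewrite // ltnNge zB -ltnNge.
  by apply/astabP => k; rewrite inE /= add0n -leqNgt /aperm aE => ->.
- apply/setIP; split.
    apply/bigcapP => i _; apply/astabsP => k; rewrite !inE /= /aperm bE.
    have [ka|ka] := leqP (sumn al) k; last by rewrite leqNgt ka.
    have := zc k; rewrite zB ka !reshape_index_catr ?zB // ?ltn_subLR ?zB ?bicomp_sum //.
    by move/addnI ->.
  apply/astabP => k; rewrite inE bicomp_sum ltn_ord andbT /= /aperm bE.
  by move/negPf ->.
apply/permP => k; rewrite pcompE bE aE.
by have [ka|ka] := leqP (sumn al) k; rewrite ?zB ?ka // leqNgt ka.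
Qed.

Lemma Tcol_Sab d z : z \in Sab ab -> Tc (d \cp z) = Tc d.
Proof.
move=> zS; apply/ffunP => x; rewrite !TcolE; apply: val_inj; rewrite !ffunE /= !tab_invK.
by rewrite /Defs.pcomp invMg permM Sab_colour // groupV.
Qed.

Lemma Tcol_inj_Sab d d' : Tc d = Tc d' -> (d^-1)%g \cp d' \in Sab ab.
Proof.
move=> /ffunP dd'; apply: colour_Sab => i; rewrite pcompE.
have := congr1 val (dd' (tab_inv t0 (d' i))).
by rewrite !TcolE !ffunE /= !tab_invK permK.
Qed.

(** Summing over all [r] and [k] turns the termwise order on counts into an order on numbers: under
    termwise inequalities, the sums agree only if all counts do. *)
Definition tab_weight (T : ctableau la ab) : nat :=
  \sum_(r < (size la).+1) \sum_(k < (size al + size be).+1)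
    upper_count (@nrow la) (fun x => T x) r k.

Lemma semistandard_row (T : ctableau la ab) x y : semistandard T ->
  nrow x = nrow y -> (ncol x <= ncol y)%N -> (T x <= T y)%N.
Proof.
move=> /forallP/(_ x)/forallP/(_ y)/and4P[Txy _ _ _] xy xy'.
by move: Txy; rewrite xy xy' eqxx.
Qed.

Lemma semistandard_col (T : ctableau la ab) x y : semistandard T ->
  ncol x = ncol y -> (nrow x <= nrow y)%N -> (T x <= T y)%N.
Proof.
move=> /forallP/(_ x)/forallP/(_ y)/and4P[_ Txy _ _] xy xy'.
by move: Txy; rewrite xy xy' eqxx.
Qed.

Lemma acoef_triangular d dd : semistandard (Tc d) -> semistandard (Tc dd) ->
  acoef ab t0 d dd != 0 ->
  (tab_weight (Tc dd) <= tab_weight (Tc d) ?= iff (Tc d == Tc dd))%N.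
Proof.
move=> dss ddss add0.
have [s sC /imset2P[r z rR zS E]] : exists2 s, s \in colstab t0 & s \cp d \in dcoset ab t0 dd.
  move: add0; rewrite /acoef; case: (pickP [pred s | (s \in colstab t0) && (s \cp d \in dcoset ab t0 dd)]).
    by move=> s /andP[sC sD] _; exists s.
  by move=> none; rewrite big_pred0 ?eqxx.
(* [act g] is the permutation of the nodes for which [Tc (g \cp d)] is [Tc d] composed with
   [act g]. *)
pose act (g : 'S_n) x := tab_inv t0 (g^-1%g (t0 x)).
have act_inj g : injective (act g).
  by move=> x y /(can_inj (tab_invK t0))/perm_inj/tab_inj.
have actE : (fun x => val (Tc d (act s x))) =1 (fun x => val (Tc dd (act r x))).
  by move=> x; rewrite -!Tcol_cp E Tcol_Sab.
have count_le i k : (upper_count (@nrow la) (fun x => Tc dd x) i k <=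
    upper_count (@nrow la) (fun x => Tc d x) i k)%N.
  rewrite -(@upper_count_row _ _ _ (act r)) //; last first.
    by move=> x; rewrite rowstab_row ?groupV // tabK.
  have <- : upper_count (@nrow la) ((fun x => val (Tc d x)) \o act s) i k =
      upper_count (@nrow la) ((fun x => val (Tc dd x)) \o act r) i k.
    by apply: eq_card => x; rewrite !inE; have /= -> := actE x.
  apply: (upper_count_max (col := @ncol la)) => //.
    by move=> x; rewrite colstab_col ?groupV // tabK.
  by move=> x y; apply: semistandard_col.
have sum_le : (tab_weight (Tc dd) <= tab_weight (Tc d) ?=
    iff [forall i : 'I_(size la).+1, forall k : 'I_(size al + size be).+1,
      upper_count (@nrow la) (fun x => Tc dd x) i k ==
      upper_count (@nrow la) (fun x => Tc d x) i k])%N.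
  apply: leqif_sum => i _; apply: leqif_sum => k _.
  by split; rewrite ?count_le.
split; first exact: sum_le.
apply/idP/eqP => [|->//]; rewrite sum_le => /forallP countE.
apply/ffunP => x; apply/val_inj/esym; move: x.
(* With this bound, every count that the row comparison needs occurs as a term of [tab_weight]. *)
have bound (T : ctableau la ab) : (\max_x T x <= size al + size be)%N.
  by apply/bigmax_leqP => x _; apply: ltnW.
apply: (@upper_count_row_inj _ (@nrow la) (@ncol la) _ _ (size la)).
- by move=> x y; apply: semistandard_row.
- by move=> x y; apply: semistandard_row.
- by move=> x; apply: ltn_ord.
move=> i k iM kM; rewrite -ltnS in iM.
have {}kM : (k < (size al + size be).+1)%N.
  by rewrite ltnS (leq_trans kM) // geq_max !bound.
by have /forallP/(_ (Ordinal kM))/eqP := countE (Ordinal iM).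
Qed.

End TableauOrder.

(** * Linear independence of the homomorphisms *)

Theorem proposition4p5 (n : nat) (n_gt0 : (0 < n)%N) (la : intpart n)
    (ab : bicomp n) (t0 : tableau la n) (Gamma : {set 'S_n})
    (GammaP : left_transversal (Sab ab) Gamma) (F : fieldType)
    (acoef_neq0 : forall d, d \in Gamma_sstd ab t0 Gamma ->
       (acoef ab t0 d d)%:~R != 0 :> F) :
  free [seq hattheta F ab t0 Gamma d | d in Gamma_sstd ab t0 Gamma].
Proof.
set e0 := vsproj (specht F la) (polytabloid F t0).
(* The functional reads off the coordinate of [f e0] at the basis vector of [d]. The default 0 for
   [d] outside [Gamma] keeps it linear for every [d]. *)
pose phi d (f : 'Hom(subvs_of (specht F la), Mab F Gamma)) : F :=
  if insub d is Some d' then f e0 d' else 0.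
have phiE d dd : d \in Gamma_sstd ab t0 Gamma -> dd \in Gamma_sstd ab t0 Gamma ->
    phi d (hattheta F ab t0 Gamma dd) = (acoef ab t0 d dd)%:~R.
  move=> dG ddG; have dGamma : d \in Gamma by move: dG; rewrite inE => /andP[].
  rewrite /phi insubT /e0 hattheta_polytabloid //; last first.
    exact: (subsetP (Gamma_sstd_calR ab t0 Gamma)).
  have -> : tab_perm t0 t0 = 1%g.
    by apply/permP => k; rewrite permE perm1 tab_invK.
  have p1s (s : 'S_n) : (1^-1)%g \cp s = s by rewrite /Defs.pcomp invg1 mulg1.
  rewrite sum_ffunE (bigD1 d) //= big1 => [|d' /andP[d'Gamma d'd]].
    rewrite addr0 ffunE (tens_basis F GammaP (Sub d dGamma)) ffunE eqxx.
    by rewrite p1s /GRing.scale /= mulr1.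
  rewrite ffunE (tens_basis F GammaP (Sub d' d'Gamma)) ffunE -val_eqE /= eq_sym.
  by rewrite (negPf d'd) scaler0.
apply: (@free_image_triangular F _ _ _ _ phi (fun d => tab_weight (Tcol ab t0 d))).
- move=> d a f g; rewrite /phi; case: insubP => [d' _ _|_]; last by rewrite mulr0 addr0.
  by rewrite add_lfunE scale_lfunE !ffunE.
- by move=> d dG; rewrite phiE // acoef_neq0.
move=> d dd dG ddG; rewrite phiE // => add0.
have [dGamma dss] : d \in Gamma /\ semistandard (Tcol ab t0 d).
  by move: dG; rewrite inE => /andP[? /andP[]].
have [ddGamma ddss] : dd \in Gamma /\ semistandard (Tcol ab t0 dd).
  by move: ddG; rewrite inE => /andP[? /andP[]].
(* Equal tableaux put [d] and [dd] in the same left coset of [Sab], which the transversal meets only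
   once. *)
have -> : (d == dd) = (Tcol ab t0 d == Tcol ab t0 dd).
  apply/eqP/eqP => [-> //|/Tcol_inj_Sab].
  exact: (transv_inj GammaP).
apply: acoef_triangular => //.
(* A coefficient that is nonzero in [F] is already nonzero as an integer. *)
by apply: contraNneq add0 => ->.
Qed.
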